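(* For every integer $n \ge 1$, the parameterized family of games get-close-to-the-target (with parameter $k \in \{1,2,\ldots,n\}$ unknown to player 1) is guaranteed BL-WoLF-learnable with loss $\lceil \log_2 n \rceil$.
   Context: Stage game. There are two players, player 1 (the learner) and player 2 (the opponent), with finite action sets $A_1, A_2$. Each pair of actions determines (deterministically, or through a probability distribution) a pair of utilities; the game is zero-sum (the utilities sum to a constant). A stage-game strategy for player $i$ is a probability distribution over $A_i$. The value $V$ of the game is $V=\max_{\sigma_1}\min_{\sigma_2}E[u_1\mid\sigma_1,\sigma_2]$, and $\sigma_1$ is a maximin strategy for player 1 if it guarantees player 1 expected utility at least $V$ against every $\sigma_2$. Repeated game. A parameterized family of stage games consists of fixed action sets $A_1,A_2$, a parameter set $K$, and a map sending each $k\in K$ to a zero-sum stage game with these action sets. One $k \in K$ is fixed, and the corresponding stage game is played over and over. Player 2 knows $k$ and player 1's learning strategy; player 1 knows only the family. After each round player 1 observes both actions and the payoffs. A learning strategy for player 1 prescribes a stage-game strategy for each history of past actions and payoffs; the opponent may likewise use any history-dependent strategy. Player 1's loss in a round is $V$ (the value of the actual stage game) minus the utility player 1 received in that round; the loss incurred over several rounds is the sum of the losses of those rounds. Guaranteed BL-WoLF-learnability. A parameter value is consistent with a history if that history's observed payoffs are possible under it given the actions. Player 1 has learned enough to construct a maximin strategy once there is a single stage-game strategy of player 1 that is a maximin strategy in every game of the family consistent with the history so far. A family is guaranteed BL-WoLF-learnable with loss $l$ if there exists a learning strategy for player 1 such that, for any game in the family and against any opponent, the cumulative loss incurred by player 1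 before learning enough about the game to construct a maximin strategy (that is, at any time up to and including the round in which this is learned, or at all times if it is never learned) is never more than $l$. The family get-close-to-the-target. For given $n$ (known to both players), both players have action set $\{1,2,\ldots,n\}$. The outcome is determined by a parameter $k\in\{1,\ldots,n\}$. Given actions $a_1,a_2$ (and writing $-i$ for the player other than $i$): if $|a_i-k|<|a_{-i}-k|$, player $i$ wins; if $a_1=a_2=a\neq k$, player 1 wins if $a<k$ and player 2 wins if $a>k$; otherwise (i.e. $a_1-k=k-a_2$) there is a draw. Winning gives utility $1$, losing gives utility $-1$, a draw gives utility $0$ to both. Player 1 initially does not know $k$. *)

(* Defs.v *)
From mathcomp Require Import all_boot all_order all_algebra finmap.
From mathcomp Require Import classical_sets reals.

Set Implicit Arguments.
Unset Strict Implicit.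
Unset Printing Implicit Defensive.

Import Order.TTheory GRing.Theory Num.Theory.

Local Open Scope fset_scope.
Local Open Scope classical_set_scope.
Local Open Scope ring_scope.

(* Finitely supported probability distributions; over a finite action set
   these are all the probability distributions. *)
Record dist (R : realType) (T : choiceType) := Dist {
  pmf :> {fsfun T -> R with 0};
  pmf_ge0 : forall x, 0 <= pmf x;
  pmf_sum1 : \sum_(x <- finsupp pmf) pmf x = 1
}.

Definition expect (R : realType) (T : choiceType) (d : dist R T) (f : T -> R)
  : R := \sum_(x <- finsupp d) d x * f x.

Section PointDist.
Variables (R : realType) (T : choiceType) (a : T).

Definition point_pmf : {fsfun T -> R with 0} := [fsfun x in [fset a] => 1].

Lemma point_pmf_ge0 x : 0 <= point_pmf x.
Proof. by rewrite fsfunE; case: ifP. Qed.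

Lemma point_pmf_sum1 : \sum_(x <- finsupp point_pmf) point_pmf x = 1.
Proof.
have -> : finsupp point_pmf = [fset a].
  apply/fsetP => x; rewrite mem_finsupp fsfunE.
  by case: ifP; rewrite ?oner_eq0 ?eqxx.
by rewrite big_seq_fset1 fsfunE inE eqxx.
Qed.

Definition point_dist : dist R T := Dist point_pmf_ge0 point_pmf_sum1.

End PointDist.

(* The pair of utilities may be random given the actions; a deterministic
   game uses point distributions. *)
Record stage_game (R : realType) (A1 A2 : finType) := StageGame {
  outcome : A1 -> A2 -> dist R (R * R)%type;
  zero_sum : exists c : R, forall a1 a2 u,
    u \in finsupp (outcome a1 a2) -> u.1 + u.2 = c
}.

Section RepeatedGame.
Variables (R : realType) (A1 A2 : finType).

Definition expected_u1 (G : stage_game R A1 A2) (s1 : dist R A1)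
    (s2 : dist R A2) : R :=
  expect s1 (fun a1 => expect s2 (fun a2 => expect (outcome G a1 a2) fst)).

(* The supremum and infimum are a maximum and a minimum, by continuity of the
   expected utility and compactness of the strategy simplices. *)
Definition value (G : stage_game R A1 A2) : R :=
  sup [set inf [set expected_u1 G s1 s2 | s2 in [set: dist R A2]]
      | s1 in [set: dist R A1]].

Definition maximin (G : stage_game R A1 A2) (s1 : dist R A1) : Prop :=
  forall s2 : dist R A2, value G <= expected_u1 G s1 s2.

(* One round is (a1, a2, (u1, u2)); histories are in chronological order. *)
Definition round : Type := (A1 * A2 * (R * R))%type.
Definition history : Type := seq round.

(* [reachable G sigma1 sigma2 h]: when G is repeatedly played under sigma1 and
   sigma2, the first [size h] rounds are h with positive probability. *)
Inductive reachable (G : stage_game R A1 A2) (sigma1 : history -> dist R A1)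
    (sigma2 : history -> dist R A2) : history -> Prop :=
| reachable_nil : reachable G sigma1 sigma2 [::]
| reachable_rcons (h : history) (a1 : A1) (a2 : A2) (u : R * R) :
    reachable G sigma1 sigma2 h ->
    a1 \in finsupp (sigma1 h) ->
    a2 \in finsupp (sigma2 h) ->
    u \in finsupp (outcome G a1 a2) ->
    reachable G sigma1 sigma2 (rcons h (a1, a2, u)).

Definition loss (G : stage_game R A1 A2) (h : history) : R :=
  \sum_(r <- h) (value G - r.2.1).

Variables (K : Type) (F : K -> stage_game R A1 A2).

Definition consistent (k : K) (h : history) : Prop :=
  forall (a1 : A1) (a2 : A2) (u : R * R),
    (a1, a2, u) \in h -> u \in finsupp (outcome (F k) a1 a2).

Definition learned_maximin (h : history) : Prop :=
  exists s1 : dist R A1, forall k : K, consistent k h -> maximin (F k) s1.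

(* Only proper prefixes are required not to have learned, so the loss bound
   also covers the round in which enough is learned. *)
Definition guaranteed_BL_WoLF_learnable (l : R) : Prop :=
  exists sigma1 : history -> dist R A1,
    forall (k : K) (sigma2 : history -> dist R A2) (h : history),
      reachable (F k) sigma1 sigma2 h ->
      (forall t : nat, (t < size h)%N -> ~ learned_maximin (take t h)) ->
      loss (F k) h <= l.

End RepeatedGame.

Section GetCloseToTheTarget.
Variables (R : realType) (n : nat).

(* Actions and targets 1, ..., n are numbered from 0 by 'I_n; the rules depend
   only on differences and comparisons, which the shift preserves. *)
Definition target_distance (k a : 'I_n) : int := `|a%:Z - k%:Z|.

Definition target_u1 (k a1 a2 : 'I_n) : R :=
  if target_distance k a1 < target_distance k a2 then 1
  else if target_distance k a2 < target_distance k a1 then -1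
  else if (a1 == a2) && (a1 != k) then (if (a1 < k)%N then 1 else -1)
  else 0.

Definition target_outcome (k a1 a2 : 'I_n) : dist R (R * R)%type :=
  point_dist R (target_u1 k a1 a2, - target_u1 k a1 a2).

Lemma target_zero_sum (k : 'I_n) : exists c : R, forall a1 a2 u,
  u \in finsupp (target_outcome k a1 a2) -> u.1 + u.2 = c.
Proof.
exists 0 => a1 a2 u; rewrite mem_finsupp fsfunE inE.
by case: ifP => [/eqP-> _|_]; rewrite /= ?subrr ?eqxx.
Qed.

Definition get_close_to_the_target (k : 'I_n) : stage_game R 'I_n 'I_n :=
  StageGame (target_zero_sum k).

End GetCloseToTheTarget.

Arguments get_close_to_the_target R n k : clear implicits.

(* Main.v *)
(* The value of every game in the family is nonpositive, since the opponent may
   play the target.  Player 1 plays the midpoint of an interval known to contain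
   the target.  A lost round reveals on which side of the midpoint the target
   lies, so each unit of loss at least halves the interval, which never becomes
   empty. *)
Require Import Defs.
From mathcomp Require Import all_boot all_order all_algebra finmap.
From mathcomp Require Import classical_sets reals.
From mathcomp Require Import zify lra.

Import Order.TTheory GRing.Theory Num.Theory.

Local Open Scope fset_scope.
Local Open Scope ring_scope.

Lemma in_finsupp_point (R : realType) (T : choiceType) (a x : T) :
  (x \in finsupp (point_dist R a)) = (x == a).
Proof.
by rewrite mem_finsupp fsfunE inE; case: ifP; rewrite ?oner_eq0 ?eqxx.
Qed.

Lemma expect_point (R : realType) (T : choiceType) (a : T) (f : T -> R) :
  expect (point_dist R a) f = f a.
Proof.
rewrite /expect; have -> : finsupp (point_dist R a) = [fset a].
  by apply/fsetP => x; rewrite in_finsupp_point inE.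
by rewrite big_seq_fset1 fsfunE inE eqxx mul1r.
Qed.

Section Target.
Variables (R : realType) (n : nat).
Implicit Types k a : 'I_n.

Lemma target_u1_opponent_hits k a : target_u1 R k a k <= 0.
Proof.
rewrite /target_u1 /target_distance.
case: ifP => [|_]; first lia.
case: ifP => [_|]; first by rewrite oppr_le0.
by case: ifP => // /andP[/eqP-> /eqP].
Qed.

Lemma target_value_le0 k : value (get_close_to_the_target R n k) <= 0.
Proof.
apply: ge_sup.
  by eexists; exists (point_dist R k).
move=> _ [s1 _ <-].
set E := (X in inf X).
(* [inf] is 0 by default on a set that has no infimum, which also satisfies the bound. *)
have [[E0 Elb]|nE] := boolp.pselect (has_inf E); last by rewrite inf_out.
apply: (@le_trans _ _ (expected_u1 (get_close_to_the_target R n k) s1 (point_dist R k))).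
  by apply: ge_inf => //; exists (point_dist R k).
apply: sumr_le0 => a _; rewrite expect_point expect_point.
by rewrite mulr_ge0_le0 ?pmf_ge0 ?target_u1_opponent_hits.
Qed.

Lemma target_u1_ge0 k a1 a2 :
  target_u1 R k a1 a2 != -1 -> 0 <= target_u1 R k a1 a2.
Proof. by rewrite /target_u1; do ! case: ifP => _; rewrite ?eqxx. Qed.

(** Were the target at [a1] or on the far side of it from [a2], player 1 would be closer. A tie with
    [a1 = a2] is lost only above the target, so equality belongs to the [else] branch. *)
Lemma target_u1_lost k a1 a2 : target_u1 R k a1 a2 = -1 ->
  if (a1 < a2)%N then (a1 < k)%N else (k < a1)%N.
Proof.
have n1 : (1 : R) <> -1 by lra.
have n0 : (0 : R) <> -1 by lra.
rewrite /target_u1 /target_distance; case: ifP => // h1.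
case: ifP => [h2 _|h2]; first by case: ifP; lia.
case: ifP => // /andP[/eqP <- /eqP ak].
case: ifP => // h3 _; rewrite ltnn ltn_neqAle leqNgt h3 andbT.
by apply/eqP => /val_inj ka; apply: ak.
Qed.

(* [(lo, hi)] stands for the targets [k] with [lo <= k < hi]. *)
Definition narrow (I : nat * nat) (r : round R 'I_n 'I_n) : nat * nat :=
  let: (a1, a2, u) := r in
  if u.1 != -1 then I else if (a1 < a2)%N then (a1.+1, I.2) else (I.1, a1 : nat).

Definition target_interval (h : history R 'I_n 'I_n) : nat * nat :=
  foldl narrow (0, n)%N h.

(** The default [k0] only makes this total: the midpoint of a nonempty interval inside [[0, n)] is a
    valid action. *)
Definition midpoint (k0 : 'I_n) (I : nat * nat) : 'I_n :=
  insubd k0 ((I.1 + I.2)./2)%N.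

Definition bisection (k0 : 'I_n) (h : history R 'I_n 'I_n) : dist R 'I_n :=
  point_dist R (midpoint k0 (target_interval h)).

Lemma bisection_invariant k0 k (sigma2 : history R 'I_n 'I_n -> dist R 'I_n) h :
  reachable (get_close_to_the_target R n k) (bisection k0) sigma2 h ->
  let I := target_interval h in
  [/\ (I.1 <= k)%N, (k < I.2)%N, (I.2 <= n)%N &
    exists2 c : nat, loss (get_close_to_the_target R n k) h <= c%:R
                   & (2 ^ c * (I.2 - I.1) <= n)%N].
Proof.
elim=> [|{}h a1 a2 u _ /= [lok khi hin [c lossc cn]] a1E _ uE].
  split=> //=; exists 0%N; first by rewrite /loss big_nil.
  by rewrite expn0 mul1n subn0.
move: uE; rewrite in_finsupp_point => /eqP->.
rewrite /target_interval foldl_rcons -/(target_interval h).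
move: a1E lok khi hin cn; rewrite in_finsupp_point.
case: (target_interval h) => lo hi /eqP a1E /= lok khi hin cn.
have a1m : a1 = ((lo + hi)./2)%N :> nat.
  by rewrite a1E /midpoint val_insubd ifT //=; lia.
have V0 := target_value_le0 k.
have lossS : loss (get_close_to_the_target R n k)
    (rcons h (a1, a2, (target_u1 R k a1 a2, - target_u1 R k a1 a2))) =
    loss (get_close_to_the_target R n k) h +
    (value (get_close_to_the_target R n k) - target_u1 R k a1 a2).
  by rewrite /loss -cats1 big_cat big_seq1.
(* A round that is not lost adds at most [value <= 0] to the loss and keeps the interval, so the
   same [c] works. *)
rewrite lossS; have [lost|/target_u1_ge0 ge0] := eqVneq; last first.
  by split=> //=; exists c => //; lra.
have := target_u1_lost _ _ _ lost.
have lossc1 : loss (get_close_to_the_target R n k) h +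
    (value (get_close_to_the_target R n k) - target_u1 R k a1 a2) <= c.+1%:R.
  by rewrite -natr1 lost; lra.
(* Both remaining sides exclude the midpoint, and even with rounding each has at most half the old
   length. *)
have halve m : (m.*2 <= hi - lo)%N -> (2 ^ c.+1 * m <= n)%N.
  by move=> mI; rewrite expnSr -mulnA mul2n (leq_trans _ cn) // leq_mul2l mI orbT.
case: ifP => _ side; split=> //=; try lia; exists c.+1 => //; apply: halve; lia.
Qed.

End Target.

Theorem theorem2 (R : realType) (n : nat) (hn : (1 <= n)%N) :
  guaranteed_BL_WoLF_learnable (get_close_to_the_target R n) (up_log 2 n)%:R.
Proof.
exists (bisection R n (Ordinal hn)) => k sigma2 h /bisection_invariant /=.
move=> [lok khi _ [c lossc cn]] _; apply: le_trans lossc _.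
(* The final interval contains [k], so its length is at least 1 and
   [2 ^ c <= n <= 2 ^ up_log 2 n]. *)
rewrite ler_nat -(leq_exp2l (m := 2)) // (leq_trans _ (up_logP n _)) //.
by apply: leq_trans cn; rewrite leq_pmulr // subn_gt0 (leq_ltn_trans lok).
Qed.
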